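(* Let $E$ be a non-zero Banach space. Then, for each maximal left ideal $\mathscr{L}$ of $\mathscr{B}(E)$, exactly one of the following two alternatives holds: (i) $\mathscr{L}$ is fixed; or (ii) $\mathscr{L}$ contains $\mathscr{F}(E)$.
   Context: All Banach spaces are complex. $\mathscr{B}(E)$ is the Banach algebra of all bounded linear operators on $E$, and $\mathscr{F}(E)$ is the two-sided ideal of finite-rank operators (those with finite-dimensional range). A maximal left ideal is a proper left ideal that is maximal among proper left ideals with respect to inclusion. For $x\in E\setminus\{0\}$ set $\mathscr{M}\!\mathscr{L}_x=\{T\in\mathscr{B}(E): Tx=0\}$, which is a maximal left ideal of $\mathscr{B}(E)$. A maximal left ideal of $\mathscr{B}(E)$ is called fixed if it equals $\mathscr{M}\!\mathscr{L}_x$ for some $x\in E\setminus\{0\}$. *)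

(* Defs.v *)
From HB Require Import structures.
From mathcomp Require Import all_boot all_order all_algebra.
From mathcomp Require Import complex.
From mathcomp Require Import boolp classical_sets functions reals.
From mathcomp Require Import topology normedtype.

Set Implicit Arguments.
Unset Strict Implicit.
Unset Printing Implicit Defensive.

Import Order.TTheory GRing.Theory Num.Theory.
Import numFieldNormedType.Exports.

Local Open Scope classical_set_scope.
Local Open Scope ring_scope.

Section BoundedOperators.
Context {K : numFieldType} (E : normedModType K).

Definition bounded_operator (f : E -> E) : Prop :=
  linear f /\ exists M : K, forall x, `|f x| <= M * `|x|.

(* The order on K may be partial (K is R[i] below); a witness M can always be
   taken nonnegative, which covers the case E = 0. *)
Lemma bounded_operator_ge0 f : bounded_operator f ->
  exists2 M : K, 0 <= M & forall x, `|f x| <= M * `|x|.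
Proof.
move=> [_ [M fM]]; exists `|M| => // x.
have Mx0 : 0 <= M * `|x| by rewrite (le_trans _ (fM x)).
by rewrite (le_trans (fM x))// -(ger0_norm Mx0) normrM normr_id.
Qed.

Definition operator_pred : {pred E -> E} := [pred f | `[< bounded_operator f >]].

Record operator := Operator {
  operator_fun :> E -> E;
  _ : operator_fun \in operator_pred }.

HB.instance Definition _ := [isSub for operator_fun].
HB.instance Definition _ := [Choice of operator by <:].

Lemma operatorP (T : operator) : bounded_operator T.
Proof. by apply/asboolP; exact: (valP T). Qed.

Lemma operator_zmod_closed : zmod_closed operator_pred.
Proof.
split=> [|f g /asboolP Bf /asboolP Bg]; apply/asboolP; split.
- by move=> a u v; rewrite /= scaler0 addr0.
- by exists 0 => x; rewrite normr0 mul0r.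
- move=> a u v; rewrite !fctE Bf.1 Bg.1 scalerBr.
  by rewrite opprD addrACA.
- have [M _ fM] := bounded_operator_ge0 Bf.
  have [N _ gN] := bounded_operator_ge0 Bg.
  exists (M + N) => x; rewrite mulrDl !fctE.
  by rewrite (le_trans (ler_normB _ _))// lerD.
Qed.

HB.instance Definition _ :=
  GRing.isZmodClosed.Build (E -> E) operator_pred operator_zmod_closed.
HB.instance Definition _ := [SubChoice_isSubZmodule of operator by <:].

Lemma operator_id_subproof : (idfun : E -> E) \in operator_pred.
Proof. by apply/asboolP; split=> //; exists 1 => x; rewrite mul1r. Qed.

Lemma operator_comp_subproof (S T : operator) :
  (S \o T : E -> E) \in operator_pred.
Proof.
apply/asboolP; split.
  by move=> a u v; rewrite /= (operatorP T).1 (operatorP S).1.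
have [M M0 SM] := bounded_operator_ge0 (operatorP S).
have [N _ TN] := bounded_operator_ge0 (operatorP T).
exists (M * N) => x /=.
by rewrite (le_trans (SM _))// -mulrA ler_wpM2l.
Qed.

Definition operator_id : operator := Operator operator_id_subproof.
Definition operator_comp (S T : operator) : operator :=
  Operator (operator_comp_subproof S T).

Lemma operator_ext (S T : operator) : S =1 T -> S = T.
Proof. by move=> ST; apply/val_inj/funext. Qed.

Fact operator_compA : associative operator_comp.
Proof. by move=> S T U; exact: operator_ext. Qed.
Fact operator_comp1l : left_id operator_id operator_comp.
Proof. by move=> T; exact: operator_ext. Qed.
Fact operator_comp1r : right_id operator_id operator_comp.
Proof. by move=> T; exact: operator_ext. Qed.
Fact operator_compDl : left_distributive operator_comp +%R.
Proof. by move=> S T U; exact: operator_ext. Qed.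
Fact operator_compDr : right_distributive operator_comp +%R.
Proof.
move=> S T U; apply: operator_ext => x /=.
by have := (operatorP S).1 1 (T x) (U x); rewrite !scale1r.
Qed.

(* Not a nzRingType: 1 = 0 when E = 0. *)
HB.instance Definition _ := GRing.Zmodule_isPzRing.Build operator
  operator_compA operator_comp1l operator_comp1r
  operator_compDl operator_compDr.

Lemma operatorDE (S T : operator) x : (S + T) x = S x + T x. Proof. by []. Qed.
Lemma operatorME (S T : operator) x : (S * T) x = S (T x). Proof. by []. Qed.
Lemma operator0E x : (0 : operator) x = 0. Proof. by []. Qed.
Lemma operator1E x : (1 : operator) x = x. Proof. by []. Qed.

Definition finite_dimensional (V : set E) : Prop :=
  exists (n : nat) (v : 'I_n -> E),
    V = range (fun c : 'I_n -> K => \sum_(i < n) c i *: v i).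

Definition finite_rank : set operator :=
  [set T | finite_dimensional (range T)].

Definition annihilator (x : E) : set operator := [set T | T x = 0].

Definition fixed_ideal (L : set operator) : Prop :=
  exists2 x : E, x != 0 & L = annihilator x.

End BoundedOperators.

Arguments finite_rank {K} E.

Notation "''B' ( E )" := (operator E) (format "''B' ( E )") : type_scope.

Section LeftIdeals.
Context {A : pzRingType}.

(* For A = 'B(E), a left ideal is automatically a linear subspace: the scalar
   multiple aT is the product (a id)T. *)
Definition left_ideal (L : set A) : Prop :=
  [/\ L 0, forall S T, L S -> L T -> L (S + T) & forall S T, L T -> L (S * T)].

Definition proper_left_ideal (L : set A) : Prop := left_ideal L /\ L <> setT.

Definition maximal_left_ideal (L : set A) : Prop :=
  proper_left_ideal L /\
  forall J : set A, proper_left_ideal J -> L `<=` J -> J = L.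

End LeftIdeals.

(* Main.v *)
Require Import Defs.
From HB Require Import structures.
From mathcomp Require Import all_boot all_order all_algebra.
From mathcomp Require Import complex.
From mathcomp Require Import boolp classical_sets functions reals.
From mathcomp Require Import topology normedtype.
From mathcomp Require Import lra.

(** The argument rests on rank-one operators [y (x) g : x |-> g x *: y], with
[g] a bounded functional, and on the fact that bounded functionals separate
the points of [E] (Hahn-Banach, proved here as [Hahn_Banach_complex]).

A left ideal containing every rank-one operator contains every finite-rank
one: peel off one spanning vector [v] of the range at a time, by composing on
the left with [1 - v (x) g] where [g v = 1]
([left_ideal_rank_one_finite_rank]).

So if a maximal left ideal [L] does not contain the finite-rank operators, it
misses some [y (x) g]. By maximality [1 = S + X * (y (x) g)] with [S] in [L];
that is, [1 - z (x) g] lies in [L] for [z = X y]. Were [g z <> 1], this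
element would be invertible, and [y (x) g] a left multiple of it; so
[g z = 1] and [z (x) g] is a projection onto the line of [z]. An operator [U]
with [U z = 0] equals [U * (1 - z (x) g)], hence lies in [L]. Thus [L] contains
the annihilator of [z]; since that annihilator is itself maximal, [L] is equal
to it ([maximal_left_ideal_fixed]). Maximality of the annihilator is where
separation matters: from [U z <> 0] a functional [h] with [h (U z) = 1] allows
one to send [U z] to any prescribed vector.

Conversely the annihilator of [z <> 0] misses [z (x) g] as soon as [g z = 1],
so the two alternatives exclude each other.

Hahn-Banach is obtained without extending functionals from subspaces. By
Zorn's lemma there is a minimal sublinear functional below a given one, and
minimal sublinear functionals are linear, because sliding such a functional
along a direction [a] gives a sublinear functional which is no larger. *)

Import Order.TTheory GRing.Theory Num.Theory.
Import numFieldNormedType.Exports.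

Local Open Scope classical_set_scope.
Local Open Scope ring_scope.

Set Implicit Arguments.
Unset Strict Implicit.

(** * Minimal sublinear functionals and the real Hahn-Banach theorem *)

Section SublinearFunctionals.
Context {R : realType} {V : lmodType R}.
Implicit Types p q : V -> R.

(** The inequality in the second clause self-improves to an equality
([sublinear_scale]); only the inequality has to be checked on examples. The
value [t = 0] is what gives [q 0 = 0]. *)
Definition sublinear q : Prop :=
  (forall x y, q (x + y) <= q x + q y) /\
  (forall t x, 0 <= t -> q (t *: x) <= t * q x).

Definition pointwise_inf (C : set (V -> R)) (x : V) : R :=
  inf [set q x | q in C].

(** [slide q a] is the largest sublinear functional [r <= q] such that
[r (- a) <= - q a]: it makes [q] as additive as possible along [a], and
differs from [q] unless [q (x + a) = q x + q a] for all [x]. *)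
Definition slide q a x : R :=
  inf [set q (x + t *: a) - t * q a | t in [set t | 0 <= t]].

Lemma sublinear_intro q : (forall x y, q (x + y) <= q x + q y) -> q 0 <= 0 ->
  (forall t x, 0 < t -> q (t *: x) <= t * q x) -> sublinear q.
Proof.
move=> qD q0 qZ; split=> // t x.
rewrite le_eqVlt => /predU1P[<-|]; last exact: qZ.
by rewrite scale0r mul0r.
Qed.

Lemma sublinear0 q : sublinear q -> q 0 = 0.
Proof.
move=> [qD qZ]; have := qD 0 0; have := qZ 0 0 (lexx 0).
rewrite scale0r addr0; lra.
Qed.

Lemma sublinear_ge q x : sublinear q -> - q (- x) <= q x.
Proof.
move=> sq; have := sq.1 x (- x); rewrite subrr sublinear0//; lra.
Qed.

Lemma sublinear_scale q t x : sublinear q -> 0 <= t -> q (t *: x) = t * q x.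
Proof.
move=> sq t0; apply/eqP; rewrite eq_le sq.2//=.
have [t_gt0|t_le0] := ltP 0 t; last first.
  have -> : t = 0 by apply/eqP; rewrite eq_le t0 t_le0.
  by rewrite mul0r scale0r sublinear0.
rewrite mulrC -ler_pdivlMr// mulrC.
have := sq.2 t^-1 (t *: x).
by rewrite scalerA mulVf ?gt_eqF// scale1r invr_ge0 ltW//; exact.
Qed.

Section Slide.
Context (q : V -> R) (a : V) (sq : sublinear q).

(** The infimum defining the slide is finite: since [q] is homogeneous,
[t * q a = q (t *: a) <= q (x + t *: a) + q (- x)], so [- q (- x)] is a lower
bound. *)
Lemma slide_le t x : 0 <= t -> slide q a x <= q (x + t *: a) - t * q a.
Proof.
move=> t0; apply: ge_inf; last by exists t.
exists (- q (- x)) => _ [s s0 <-].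
have := sublinear_scale a sq s0; have := sq.1 (x + s *: a) (- x).
rewrite addrAC subrr add0r; lra.
Qed.

Lemma slide_ge x c :
  (forall t, 0 <= t -> c <= q (x + t *: a) - t * q a) -> c <= slide q a x.
Proof.
move=> cP; apply: lb_le_inf.
  by exists (q (x + 0 *: a) - 0 * q a), 0 => /=.
by move=> _ [t t0 <-]; exact: cP.
Qed.

Lemma slide_le_self x : slide q a x <= q x.
Proof.
by have := @slide_le 0 x (lexx 0); rewrite scale0r addr0 mul0r subr0.
Qed.

Lemma slide_opp : slide q a (- a) <= - q a.
Proof.
have := @slide_le 1 (- a) ler01.
by rewrite scale1r addNr sublinear0// mul1r sub0r.
Qed.

(** Two slides by [s] and [t] combine into one by [s + t], which gives
subadditivity; homogeneity comes from rescaling the parameter [s] into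
[t * s]. *)
Lemma slide_sublinear : sublinear (slide q a).
Proof.
apply: sublinear_intro => [x y||t x t0].
- rewrite -lerBlDr; apply: slide_ge => s s0; rewrite lerBlDr -lerBlDl.
  apply: slide_ge => t t0; rewrite lerBlDl.
  have := slide_le (x + y) (addr_ge0 s0 t0).
  have := sq.1 (x + s *: a) (y + t *: a).
  rewrite addrACA -scalerDl; lra.
- by rewrite -(sublinear0 sq) slide_le_self.
rewrite mulrC -ler_pdivrMr//; apply: slide_ge => s s0; rewrite ler_pdivrMr//.
have := slide_le (t *: x) (mulr_ge0 (ltW t0) s0).
have := sq.2 t (x + s *: a) (ltW t0); rewrite scalerDr scalerA; lra.
Qed.

End Slide.

Section Chain.
Context (C : set (V -> R)) (p q0 : V -> R) (Cq0 : C q0).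
Context (Cp : forall q, C q -> sublinear q /\ forall x, q x <= p x).

(** Every member of [C] is at least [- p (- x)] at [x], so the infimum is
finite. *)
Lemma pointwise_inf_le q x : C q -> pointwise_inf C x <= q x.
Proof.
move=> Cq; apply: ge_inf; last by exists q.
exists (- p (- x)) => _ [r Cr <-]; have [sr rp] := Cp Cr.
by have := sublinear_ge x sr; have := rp (- x); lra.
Qed.

Lemma pointwise_inf_ge x c :
  (forall q, C q -> c <= q x) -> c <= pointwise_inf C x.
Proof.
move=> cP; apply: lb_le_inf; first by exists (q0 x), q0.
by move=> _ [q Cq <-]; exact: cP.
Qed.

(** For [q] and [r] in the chain, the smaller of the two bounds the infimum at
[x + y] by [q x + r y]; this is where [C] being a chain matters. *)
Lemma pointwise_inf_sublinear :
  total_on C (fun q r => forall x, r x <= q x) -> sublinear (pointwise_inf C).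
Proof.
move=> Ctot; apply: sublinear_intro => [x y||t x t0].
- rewrite -lerBlDr; apply: pointwise_inf_ge => q Cq; rewrite lerBlDr -lerBlDl.
  apply: pointwise_inf_ge => r Cr; rewrite lerBlDl.
  have [qr|rq] := Ctot _ _ Cq Cr.
    have := pointwise_inf_le (x + y) Cr; have := (Cp Cr).1.1 x y.
    have := qr x; lra.
  have := pointwise_inf_le (x + y) Cq; have := (Cp Cq).1.1 x y.
  have := rq y; lra.
- by rewrite -(sublinear0 (Cp Cq0).1) pointwise_inf_le.
rewrite mulrC -ler_pdivrMr//; apply: pointwise_inf_ge => q Cq.
rewrite ler_pdivrMr// mulrC (le_trans (pointwise_inf_le _ Cq))//.
exact: (Cp Cq).1.2 (ltW t0).
Qed.

End Chain.

(** Zorn's lemma for the reversed pointwise order: the infimum of a chain of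
sublinear functionals below [p] is again one. *)
Lemma minimal_sublinear p : sublinear p ->
  exists q, [/\ sublinear q, forall x, q x <= p x &
    forall r, sublinear r -> (forall x, r x <= q x) -> forall x, q x <= r x].
Proof.
move=> sp; pose D := {q | sublinear q /\ forall x, q x <= p x}.
pose below (q r : D) := `[< forall x, sval r x <= sval q x >].
have [|q r s /asboolP qr /asboolP rs|A Atot|[q [sq qp]] qmin] :=
    @ZL_preorder D (exist _ p (conj sp (fun=> lexx _))) below.
- by move=> q; apply/asboolP.
- by apply/asboolP => x; exact: le_trans (rs x) (qr x).
- have [[q0 Aq0]|A0] := pselect (A !=set0); last first.
    (* The empty chain is bounded by [p] itself. *)
    exists (exist _ p (conj sp (fun=> lexx _))) => q Aq.
    by exfalso; apply: A0; exists q.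
  pose C := [set sval q | q in A].
  have Cq0 : C (sval q0) by exists q0.
  have Cp q : C q -> sublinear q /\ forall x, q x <= p x.
    by move=> [r _ <-]; exact: (svalP r).
  have Ctot : total_on C (fun q r => forall x, r x <= q x).
    move=> _ _ [q Aq <-] [r Ar <-].
    by have [/asboolP|/asboolP] := Atot _ _ Aq Ar; [left|right].
  have infp x : pointwise_inf C x <= p x.
    by rewrite (le_trans (pointwise_inf_le Cp _ Cq0))// (Cp _ Cq0).2.
  have infS := pointwise_inf_sublinear Cq0 Cp Ctot.
  exists (exist _ (pointwise_inf C) (conj infS infp)) => q Aq.
  by apply/asboolP => x /=; apply: (pointwise_inf_le Cp); exists q.
exists q; split=> // r sr rq.
have rp x : r x <= p x := le_trans (rq x) (qp x).
by apply/asboolP/(qmin (exist _ r (conj sr rp)))/asboolP.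
Qed.

(** By minimality [q] is below its slide along every [a], and in particular
[q x <= q (x + a) - q a], the missing half of additivity. *)
Lemma minimal_sublinear_scalar q : sublinear q ->
  (forall r, sublinear r -> (forall x, r x <= q x) -> forall x, q x <= r x) ->
  scalar q.
Proof.
move=> sq qmin.
have qD x a : q (x + a) = q x + q a.
  apply/eqP; rewrite eq_le sq.1 /=.
  have := qmin _ (slide_sublinear a sq) (slide_le_self a sq) x.
  have := slide_le a sq x ler01; rewrite scale1r mul1r; lra.
have qN x : q (- x) = - q x.
  by have := qD x (- x); rewrite subrr sublinear0//; lra.
have qZ0 t x : 0 <= t -> q (t *: x) = t * q x by exact: sublinear_scale.
move=> t x y; rewrite qD; congr (_ + _).
have [/qZ0//|t_lt0] := leP 0 t.
have := qZ0 (- t) x; rewrite scaleNr qN oppr_ge0 => /(_ (ltW t_lt0)); lra.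
Qed.

(** Taking a minimal functional below the slide of [p] along [z], rather than
below [p], forces [u (- z) <= - p z], hence equality at [z]. *)
Theorem Hahn_Banach_real p z : sublinear p ->
  exists u : V -> R, [/\ scalar u, forall x, u x <= p x & u z = p z].
Proof.
move=> sp; have [u [su ule umin]] := minimal_sublinear (slide_sublinear z sp).
have lu := minimal_sublinear_scalar su umin.
have up x : u x <= p x := le_trans (ule x) (slide_le_self z sp x).
exists u; split=> //; apply/eqP; rewrite eq_le up /=.
have := ule (- z); have := slide_opp z sp; have := sublinear_ge (- z) su.
rewrite opprK; lra.
Qed.

End SublinearFunctionals.

(** * Bounded functionals on complex normed spaces *)

Definition bounded_functional {K : numFieldType} {E : normedModType K}
    (g : E -> K) : Prop :=
  scalar g /\ exists M : K, forall x, `|g x| <= M * `|x|.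

Definition separating_dual {K : numFieldType} (E : normedModType K) : Prop :=
  forall z : E, z != 0 -> exists2 g : E -> K, bounded_functional g & g z = 1.

Section ComplexHahnBanach.
Local Open Scope complex_scope.

(** The alias carries the restriction of scalars, so that the real theorem
applies without putting a second module structure on [V]. *)
Definition realified {R : realType} (V : lmodType R[i]) : Type := V.

Section Realified.
Context {R : realType} (V : lmodType R[i]).

HB.instance Definition _ := GRing.Zmodule.on (realified V).

Let real_scale (t : R) (x : realified V) : realified V := t%:C *: (x : V).

Fact real_scaleA s t x : real_scale s (real_scale t x) = real_scale (s * t) x.
Proof. by rewrite /real_scale scalerA rmorphM. Qed.
Fact real_scale1 : left_id 1 real_scale.
Proof. by move=> x; rewrite /real_scale rmorph1 scale1r. Qed.
Fact real_scaleDr : right_distributive real_scale +%R.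
Proof. by move=> t x y; rewrite /real_scale scalerDr. Qed.
Fact real_scaleDl x : {morph real_scale^~ x : s t / s + t}.
Proof. by move=> s t; rewrite /real_scale rmorphD scalerDl. Qed.

HB.instance Definition _ := GRing.Zmodule_isLmodule.Build R (realified V)
  real_scaleA real_scale1 real_scaleDr real_scaleDl.

Lemma realified_scaleE (t : R) (x : V) : t *: (x : realified V) = t%:C *: x.
Proof. by []. Qed.

End Realified.

(** A complex functional is determined by its real part [u], through
[f x = u x - 'i * u ('i x)]; this formula turns any real-linear [u] into a
complex-linear [f]. *)
Lemma complex_scalar {R : realType} {V : lmodType R[i]}
    (u : realified V -> R) : scalar u ->
  scalar (fun x : V => u x +i* - u ('i *: x)).
Proof.
move=> lu.
have uD x y : u (x + y) = u x + u y by have := lu 1 x y; rewrite scale1r mul1r.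
have u0 : u 0 = 0 by have := uD 0 0; rewrite addr0; lra.
have uZ (t : R) (x : V) : u (t%:C *: x) = t * u x.
  by have := lu t x 0; rewrite !addr0 u0 addr0 realified_scaleE.
move=> [a b] x y.
have cE : a +i* b = a%:C + b%:C * 'i by simpc.
have uE : u ((a +i* b) *: x + y) = a * u x + b * u ('i *: x) + u y.
  by rewrite uD cE scalerDl uD -scalerA !uZ.
have uiE : u ('i *: ((a +i* b) *: x + y)) =
    a * u ('i *: x) - b * u x + u ('i *: y).
  have -> : 'i *: ((a +i* b) *: x + y) =
      a%:C *: ('i *: x) + (- b)%:C *: x + 'i *: y.
    rewrite scalerDr !scalerA -scalerDl; congr (_ *: _ + _).
    by simpc.
  by rewrite !uD !uZ mulNr.
rewrite uE uiE; apply/eqP; rewrite eq_complex /=.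
by apply/andP; split; apply/eqP; lra.
Qed.

(** The real functional [u] below the norm with [u z = `|z|] is the real part of
a complex functional [f]. Dividing by [f z] is harmless since
[Re (f z) = `|z| <> 0], and the crude bound [`|f x| <= 2 * `|x|] is enough for
boundedness. *)
Theorem Hahn_Banach_complex {R : realType} (E : normedModType R[i]) :
  separating_dual E.
Proof.
move=> z z_neq0; pose p (x : realified E) : R := complex.Re `|x : E|.
have pE (x : E) : (p x)%:C = `|x|.
  by rewrite RRe_real// normr_real.
have sp : sublinear p.
  split=> [x y|t x t0].
    by rewrite -lecR rmorphD /= !pE ler_normD.
  by rewrite -lecR rmorphM /= !pE realified_scaleE normrZ ger0_norm ?ler0c.
have [u [lu up uz]] := @Hahn_Banach_real R (realified E) p z sp.
pose f (x : E) := u x +i* - u ('i *: x).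
have lf : scalar f := complex_scalar lu.
have fz : f z != 0.
  apply/eqP => /(congr1 (@complex.Re R)) /=; rewrite uz => pz0.
  by move: z_neq0; rewrite -normr_eq0 -pE pz0 eqxx.
have u_norm (x : E) : `|u x|%:C <= `|x|.
  rewrite -pE lecR ler_norml up andbT.
  have u0 : u 0 = 0 by have := lu 1 0 0; rewrite scaler0 addr0 mul1r; lra.
  have := lu (-1) x 0; rewrite !addr0 u0 addr0 scaleN1r => uN.
  have := up (- x); rewrite uN /p normrN; lra.
have f_norm x : `|f x| <= 2 * `|x|.
  have -> : f x = (u x)%:C - (u ('i *: x))%:C * 'i by rewrite /f; simpc.
  have ni : `|'i : R[i]| = 1 by rewrite normc_def /= expr0n expr1n add0r sqrtr1.
  have nC (t : R) : `|t%:C : R[i]| = `|t|%:C.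
    by rewrite normc_def /= expr0n addr0 sqrtr_sqr.
  rewrite (le_trans (ler_normB _ _))// normrM ni mulr1 !nC mulr_natl mulr2n.
  by rewrite lerD// (le_trans (u_norm _))// normrZ ni mul1r.
exists (fun x => (f z)^-1 * f x); last by rewrite mulVf.
split=> [a x y|]; first by rewrite lf mulrDr mulrCA.
by exists (`|(f z)^-1| * 2) => x; rewrite normrM -mulrA ler_wpM2l.
Qed.

End ComplexHahnBanach.

(** * Rank-one operators *)

Section RankOne.
Context {K : numFieldType} {E : normedModType K}.

Lemma rank_one_subproof (y : E) (g : E -> K) :
  bounded_functional g -> (fun x => g x *: y) \in operator_pred (E := E).
Proof.
move=> [lg [M gM]]; apply/asboolP; split=> [a u v|].
  by rewrite lg scalerDl scalerA.
exists (M * `|y|) => x; rewrite normrZ.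
by rewrite (le_trans (ler_wpM2r (normr_ge0 y) (gM x)))// mulrAC.
Qed.

Definition rank_one (y : E) g (bg : bounded_functional g) : 'B(E) :=
  Operator (rank_one_subproof y bg).

Lemma rank_oneE y g (bg : bounded_functional g) x : rank_one y bg x = g x *: y.
Proof. by []. Qed.

Lemma operator_zero (T : 'B(E)) : T 0 = 0.
Proof.
by have := (operatorP T).1 (-1) 0 0; rewrite scaler0 addr0 scaleN1r addNr.
Qed.

Lemma operatorZ (T : 'B(E)) (a : K) x : T (a *: x) = a *: T x.
Proof.
by have := (operatorP T).1 a x 0; rewrite addr0 operator_zero addr0.
Qed.

Lemma mul_rank_one (T : 'B(E)) y g (bg : bounded_functional g) :
  T * rank_one y bg = rank_one (T y) bg.
Proof.
by apply: operator_ext => x; rewrite operatorME !rank_oneE operatorZ.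
Qed.

Lemma comp_bounded_functional g (T : 'B(E)) :
  bounded_functional g -> bounded_functional (g \o T).
Proof.
move=> [lg [M gM]]; split=> [a u v|].
  by rewrite /= (operatorP T).1 lg.
have [N _ TN] := bounded_operator_ge0 (operatorP T).
exists (`|M| * N) => x /=; rewrite -mulrA (le_trans (gM _))//.
have M0 : 0 <= M * `|T x| := le_trans (normr_ge0 _) (gM (T x)).
rewrite -(ger0_norm M0) normrM normr_id.
by rewrite ler_wpM2l.
Qed.

Lemma rank_one_mul y g (bg : bounded_functional g) (T : 'B(E)) :
  rank_one y bg * T = rank_one y (comp_bounded_functional T bg).
Proof. exact: operator_ext. Qed.

Lemma rank_one_finite_rank y g (bg : bounded_functional g) :
  finite_rank E (rank_one y bg).
Proof.
(* The range must be exactly a span: the line of [y], or, when [g = 0], the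
   span of no vector at all. *)
have [[x gx]|g0] := pselect (exists x, g x != 0).
  exists 1%N, (fun=> y); apply/seteqP; split=> [_ [u _ <-]|_ [c _ <-]].
    by exists (fun=> g u) => //; rewrite big_ord1.
  exists ((c ord0 / g x) *: x) => //.
  by rewrite operatorZ rank_oneE scalerA divfK// big_ord1.
exists 0%N, (fun=> y); apply/seteqP; split=> [_ [u _ <-]|_ [c _ <-]].
  exists (fun=> 0) => //; rewrite big_ord0 rank_oneE.
  have [->|gu] := eqVneq (g u) 0; first by rewrite scale0r.
  by exfalso; apply: g0; exists u.
by exists 0 => //; rewrite big_ord0 operator_zero.
Qed.

End RankOne.

(** * Maximal left ideals *)

(** The left ideal [L + A T] is strictly larger than [L], so it contains [1]. *)
Lemma maximal_left_ideal_split (A : pzRingType) (L : set A) (T : A) :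
  maximal_left_ideal L -> ~ L T -> exists X : A, L (1 - X * T).
Proof.
move=> [[[L0 LD LM] LT] Lmax] nLT.
pose J := [set S | exists X, L (S - X * T)].
have LJ : left_ideal J.
  split=> [|S S' [X SX] [X' SX']|S S' [X SX]].
  - by exists 0; rewrite mul0r subr0.
  - by exists (X + X'); rewrite mulrDl opprD addrACA; exact: LD.
  - by exists (S * X); rewrite -mulrA -mulrBr; exact: LM.
have [J1|nJ1] := pselect (J 1); first exact: J1.
exfalso; apply: nLT; rewrite -(Lmax J).
- by exists 1; rewrite mul1r subrr.
- by split=> // JT; apply: nJ1; rewrite JT.
- by move=> S LS; exists 0; rewrite mul0r subr0.
Qed.

Section LeftIdeals.
Context {K : numFieldType} {E : normedModType K} (sepE : separating_dual E).

(** Induction on the number of spanning vectors of the range: if [g v = 1] for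
the last one [v], then [(1 - v (x) g) * T] has its range spanned by the images
of the others, and the rest of [T] is the rank-one operator
[v (x) (g \o T)]. *)
Lemma left_ideal_rank_one_finite_rank (L : set 'B(E)) : left_ideal L ->
  (forall y g (bg : bounded_functional g), L (rank_one y bg)) ->
  finite_rank E `<=` L.
Proof.
move=> [L0 LD LM] Lr T [n [v rT]].
have {rT} : forall x, exists c : 'I_n -> K, T x = \sum_(i < n) c i *: v i.
  move=> x; have : range T (T x) by exists x.
  by rewrite rT => -[c _ <-]; exists c.
elim: n v T => [|n IHn] v T rT.
  have -> : T = 0.
    by apply: operator_ext => x; have [c ->] := rT x; rewrite big_ord0.
  exact: L0.
have [v0|v_neq0] := eqVneq (v ord_max) 0.
  apply: (IHn (fun i => v (widen_ord (leqnSn n) i))) => x; have [c ->] := rT x.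
  exists (fun i => c (widen_ord (leqnSn n) i)).
  by rewrite big_ord_recr /= v0 scaler0 addr0.
have [g bg gv] := sepE v_neq0.
have -> : T = (1 - rank_one (v ord_max) bg) * T + rank_one (v ord_max) bg * T.
  by rewrite -mulrDl subrK mul1r.
apply: LD; last by rewrite rank_one_mul.
apply: (IHn (fun i => v (widen_ord (leqnSn n) i)
    - g (v (widen_ord (leqnSn n) i)) *: v ord_max)) => x.
have [c Tx] := rT x; exists (fun i => c (widen_ord (leqnSn n) i)).
pose Q := 1 - rank_one (v ord_max) bg.
have QE y : Q y = y - g y *: v ord_max by [].
have QD y z : Q (y + z) = Q y + Q z.
  by have := (operatorP Q).1 1 y z; rewrite !scale1r.
have Qsum (F : 'I_n -> E) : Q (\sum_(i < n) F i) = \sum_(i < n) Q (F i).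
  exact: (big_morph Q QD (operator_zero Q)).
rewrite operatorME -/Q Tx big_ord_recr QD Qsum operatorZ.
rewrite (QE (v ord_max)) gv scale1r subrr scaler0 addr0.
by apply: eq_bigr => i _; rewrite operatorZ QE.
Qed.

(** Maximality of the annihilator of [z]: with [h (U z) = 1], any operator [V]
agrees at [z] with [(V z (x) h) * U], an element of [J]. *)
Lemma left_ideal_annihilator (J : set 'B(E)) (z : E) U : left_ideal J ->
  annihilator z `<=` J -> J U -> U z != 0 -> J = setT.
Proof.
move=> [J0 JD JM] zJ JU Uz; apply/seteqP; split=> // V _.
have [h bh hUz] := sepE Uz.
rewrite -(subrK (rank_one (V z) bh * U) V); apply: JD; last exact: JM.
apply: zJ; suff : V z - h (U z) *: V z = 0 by [].
by rewrite hUz scale1r subrr.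
Qed.

(** The vector whose annihilator is [L] is [z = X y], where [X] is such that
[1 - X * (y (x) g) = 1 - z (x) g] lies in [L]; this forces [z (x) g] to be a
projection. *)
Lemma maximal_left_ideal_fixed (L : set 'B(E)) y g
    (bg : bounded_functional g) :
  maximal_left_ideal L -> ~ L (rank_one y bg) -> fixed_ideal L.
Proof.
move=> maxL nLr; have [[lL LT] _] := maxL; have [L0 LD LM] := lL.
have [X] := maximal_left_ideal_split maxL nLr.
rewrite mul_rank_one; set z := X y => LP.
have gz : g z = 1.
  have [//|gz] := eqVneq (g z) 1; exfalso; apply: nLr.
  (* [g \o (1 - z (x) g)] is the nonzero multiple [1 - g z] of [g]. *)
  have -> : rank_one y bg =
      rank_one ((1 - g z)^-1 *: y) bg * (1 - rank_one z bg).
    apply: operator_ext => x.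
    have -> : (rank_one ((1 - g z)^-1 *: y) bg * (1 - rank_one z bg)) x =
      g (x - g x *: z) *: ((1 - g z)^-1 *: y) by [].
    have -> : g (x - g x *: z) = g x * (1 - g z).
      by rewrite -scaleNr addrC bg.1 mulNr mulrBr mulr1 addrC.
    by rewrite scalerA mulfK// subr_eq0 eq_sym.
  exact: LM.
(* If [U z = 0] then [U * (z (x) g) = 0], so [U = U * (1 - z (x) g)]. *)
have zL : annihilator z `<=` L.
  move=> U Uz; rewrite -[U](subrK (U * rank_one z bg)) mul_rank_one Uz.
  apply: LD; last first.
    suff -> : rank_one 0 bg = 0 by [].
    by apply: operator_ext => x; rewrite rank_oneE scaler0.
  by rewrite -Uz -mul_rank_one -[X in X - _]mulr1 -mulrBr; exact: LM.
exists z.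
  apply/eqP => z0; have := gz; have := bg.1 (-1) 0 0.
  rewrite z0 scaler0 addr0 mulN1r addNr => -> /eqP.
  by rewrite eq_sym oner_eq0.
apply/seteqP; split=> // U LU; have [//|Uz] := eqVneq (U z) 0.
by exfalso; apply: LT; exact: left_ideal_annihilator lL zL LU Uz.
Qed.

Lemma fixed_ideal_finite_rank (L : set 'B(E)) :
  fixed_ideal L -> ~ (finite_rank E `<=` L).
Proof.
move=> [z z_neq0 ->] FL; have [g bg gz] := sepE z_neq0.
have := FL _ (rank_one_finite_rank z bg).
by rewrite /annihilator /= gz scale1r; exact/eqP.
Qed.

End LeftIdeals.

Theorem theorem1p1 (R : realType) (E : completeNormedModType R[i])
    (E_neq0 : exists x : E, x != 0) (L : set 'B(E))
    (maxL : maximal_left_ideal L) :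
  (fixed_ideal L /\ ~ (finite_rank E `<=` L)) \/
  (~ fixed_ideal L /\ finite_rank E `<=` L).
Proof.
have sepE := Hahn_Banach_complex (E := E).
have [Lr|] := pselect (forall y g (bg : bounded_functional g),
    L (rank_one y bg)).
  have FL : finite_rank E `<=` L.
    by apply: left_ideal_rank_one_finite_rank => //; case: maxL => -[].
  by right; split=> // fL; exact: fixed_ideal_finite_rank fL FL.
move=> /existsNP[y /existsNP[g /existsNP[bg nLr]]].
have fL := maximal_left_ideal_fixed sepE maxL nLr.
by left; split=> //; exact: fixed_ideal_finite_rank.
Qed.
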